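(* Let $X$ be a Banach space having a biorthogonal system whose cardinality is not a Kunen cardinal. Then there exists an equivalent norm on $X$ which is not $\mathrm{Ba}(X_w)$-measurable.
   Context: A cardinal $\kappa$ is a Kunen cardinal if $\mathcal{P}(\kappa\times\kappa)=\mathcal{P}(\kappa)\otimes\mathcal{P}(\kappa)$, i.e. the power set of $\kappa\times\kappa$ coincides with the $\sigma$-algebra on $\kappa\times\kappa$ generated by all products $A\times B$ with $A,B\subset\kappa$. Banach spaces are real. A biorthogonal system in $X$ is a family $\{(x_\alpha,x_\alpha^* ):\alpha\in I\}\subset X\times X^*$ with $x_\alpha^*(x_\beta)=1$ if $\alpha=\beta$ and $x_\alpha^*(x_\beta)=0$ if $\alpha\neq\beta$; its cardinality is $|I|$. $X_w$ is $X$ equipped with its weak topology, and $\mathrm{Ba}(X_w)$ is the $\sigma$-algebra on $X$ generated by all weakly continuous real-valued functions on $X$ (it is well known that it equals the $\sigma$-algebra generated by $X^*$). A norm on $X$ is $\mathrm{Ba}(X_w)$-measurable if it is measurable as a real-valued function on $(X,\mathrm{Ba}(X_w))$. *)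

(* Defs.v *)
From HB Require Import structures.
From mathcomp Require Import all_boot all_order all_algebra.
From mathcomp Require Import all_classical all_reals all_analysis.
Import Order.TTheory GRing.Theory Num.Theory.
Import numFieldNormedType.Exports.

Set Implicit Arguments.
Unset Strict Implicit.
Unset Printing Implicit Defensive.

Local Open Scope classical_set_scope.
Local Open Scope ring_scope.

(* A cardinal is represented by an arbitrary type [K] of that cardinality;
   [Kunen_bij] shows that the choice of [K] does not matter. *)
Definition Kunen (K : Type) : Prop :=
  <<s [set A `*` B | A in [set: set K] & B in [set: set K]] >> =
  [set: set (K * K)].

Lemma Kunen_bij (K L : Type) (f : K -> L) : bijective f -> Kunen K -> Kunen L.
Proof.
move=> [g gf fg] kK.
pose h (p : L * L) := (g p.1, g p.2).
pose G M := [set A `*` B | A in [set: set M] & B in [set: set M]].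
rewrite /Kunen -subTset => C _.
pose D := [set p : K * K | C (f p.1, f p.2)].
have -> : C = h @^-1` D by apply/seteqP; split=> -[a b]; rewrite /D /= !fg.
have : <<s G K >> D by rewrite kK.
apply: (smallest_sub (C := sigma_algebra setT)
  (X := [set D | <<s G L >> (h @^-1` D)])).
- split=> /= [|A sA|F sF].
  + by rewrite preimage_set0; exact: sigma_algebra0.
  + exact: (sigma_algebraCD sA).
  + by rewrite preimage_bigcup; exact: sigma_algebra_bigcup.
- move=> _ [A _] [B _] <- /=; apply: sub_sigma_algebra.
  by exists (g @^-1` A) => //; exists (g @^-1` B).
Qed.

Section weak_topology.
Context {R : realType}.
Implicit Type X : normedModType R.

Definition dual X : Type := {f : {linear X -> R^o} | continuous f}.

Definition dual_fun X (f : dual X) : X -> R := sval f.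
Coercion dual_fun : dual >-> Funclass.

Definition weak X : topologicalType :=
  sup_topology (fun f : dual X =>
    Topological.class (initial_topology (f : X -> R))).

Definition weak_baire X : set (set X) :=
  \bigcup_(f in [set f : weak X -> R | continuous f])
    preimage_set_system [set: X] f measurable.

Definition Ba X := g_sigma_algebraType (@weak_baire X).

End weak_topology.

Definition biorthogonal (R : realType) (X : normedModType R) (I : Type)
    (x : I -> X) (xs : I -> dual X) : Prop :=
  forall a b : I, (a = b -> xs a (x b) = 1) /\ (a <> b -> xs a (x b) = 0).

(* The same axioms as the library's [Lmodule_isNormed]; nonnegativity follows
   from them. *)
Definition norm_on (R : realType) (X : lmodType R) (N : X -> R) : Prop :=
  [/\ forall x y, N (x + y) <= N x + N y,
      forall (l : R) x, N (l *: x) = `|l| * N x &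
      forall x, N x = 0 -> x = 0].

Definition equivalent_norm (R : realType) (X : normedModType R)
    (N : X -> R) : Prop :=
  norm_on N /\
  exists c C : R, [/\ 0 < c, 0 < C & forall x, c * `|x| <= N x <= C * `|x|].

(* Main.v *)
Require Import Defs.
From mathcomp Require Import all_boot all_order all_algebra.
From mathcomp Require Import all_classical all_reals all_analysis.
From mathcomp Require Import measurable_realfun ring lra.
Import Order.TTheory GRing.Theory Num.Theory.
Import numFieldNormedType.Exports.

(* If every equivalent norm were Ba(X_w)-measurable, every off-diagonal set C of
   pairs would lie in the product sigma-algebra, hence so would the diagonal and
   then every set of pairs.  Indeed, put u_a = x_a^* / M_a and y_a = M_a x_a, with
   M_a a bound for x_a^*; let p(z) be the supremum of |u_c(z) + 2 u_d(z)| over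
   (c, d) in C.  Both |z| and |z| + p(z) are equivalent norms, so p is measurable,
   and p(y_a + 2 y_b) = 5 exactly when (a, b) is in C.  By Edgar's theorem
   Ba(X_w) is generated by X^*, and a functional pulled back along
   (a, b) |-> y_a + 2 y_b has the form f(a) + g(b), which is measurable for the
   product sigma-algebra. *)

Set Implicit Arguments.
Unset Strict Implicit.
Unset Printing Implicit Defensive.

Local Open Scope classical_set_scope.
Local Open Scope ring_scope.

(** * Finite families of linear forms *)

Section scalar_forms.
Context (R : realFieldType) (V : lmodType R).
Implicit Types (g : V -> R) (h : nat -> V -> R) (z w : V).

Lemma scalar_form0 g : scalar g -> g 0 = 0.
Proof. by move=> lg; have := lg (-1) 0 0; rewrite scaler0 addr0 mulN1r addNr. Qed.

Lemma scalar_formD g : scalar g -> {morph g : z w / z + w}.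
Proof. by move=> lg z w; have := lg 1 z w; rewrite scale1r mul1r. Qed.

Lemma scalar_formZ g : scalar g -> forall a z, g (a *: z) = a * g z.
Proof.
by move=> lg a z; have := lg a z 0; rewrite scalar_form0 // !addr0.
Qed.

Lemma scalar_formB g : scalar g -> {morph g : z w / z - w}.
Proof.
by move=> lg z w; rewrite scalar_formD // -scaleN1r scalar_formZ // mulN1r.
Qed.

(** By induction on [n], [g] is a linear combination of the first [n] forms; [C] adds up the
    absolute values of the coefficients. *)
Lemma ker_sub_bounded (n : nat) h g :
  (forall i, scalar (h i)) -> scalar g ->
  (forall z, (forall i, (i < n)%N -> h i z = 0) -> g z = 0) ->
  exists2 C, 0 <= C & forall z d, 0 <= d ->
    (forall i, (i < n)%N -> `|h i z| <= d) -> `|g z| <= C * d.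
Proof.
move=> lh; elim: n g => [|n IHn] g lg kg.
  by exists 0 => // z d d0 _; rewrite kg // normr0 mul0r.
have [hn|/existsNP[w /not_implyP[hw /eqP hnw]]] :=
    pselect (forall z, (forall i, (i < n)%N -> h i z = 0) -> h n z = 0).
  have [|C C0 HC] := IHn _ lg.
    move=> z hz; apply: kg => i; rewrite ltnS leq_eqVlt => /predU1P[->|/hz//].
    exact: hn.
  by exists C => // z d d0 hd; apply: HC => // i /ltnW; exact: hd.
(* With this [c], [g - c * h n] vanishes at [w], hence on the whole common kernel of the first [n]
   forms. *)
pose c := g w / h n w.
have [||C C0 HC] := IHn (fun z => g z - c * h n z).
- by move=> a u v; rewrite /= lg lh; ring.
- move=> z hz; rewrite /=.
  suff : g (z - (h n z / h n w) *: w) = 0.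
    rewrite scalar_formB // scalar_formZ // => /eqP; rewrite subr_eq0 => /eqP ->.
    by rewrite /c; field.
  apply: kg => i; rewrite ltnS leq_eqVlt scalar_formB // scalar_formZ //.
  move=> /predU1P[->|ni]; first by field.
  by rewrite (hz i ni) (hw i ni) mulr0 subr0.
- exists (C + `|c|); first by rewrite addr_ge0.
  move=> z d d0 hd; rewrite -(subrK (c * h n z) (g z)).
  rewrite (le_trans (ler_normD _ _)) // mulrDl lerD //.
    by apply: HC => // i ni; apply: hd; rewrite ltnS ltnW.
  by rewrite normrM ler_wpM2l // hd.
Qed.

(* Linear independence of [l 0], ..., [l (k - 1)] modulo the span of the [e i], put
   as simultaneous solvability. *)
Definition indep_mod (e : nat -> V -> R) (k : nat) (l : nat -> V -> R) :=
  forall n (v : nat -> R), exists w,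
    (forall i, (i < n)%N -> e i w = 0) /\ (forall j, (j < k)%N -> l j w = v j).

(** Run through the forms [g i]: one that vanishes on the common kernel of finitely many [e i] and
    of those selected so far is controlled by them through [ker_sub_bounded]; any other one is added
    to the selection, which stays independent modulo the [e i]. *)
Lemma split_forms (e g : nat -> V -> R) (m : nat) :
  (forall i, scalar (e i)) -> (forall i, scalar (g i)) ->
  exists n k (s : nat -> nat) C, [/\ indep_mod e k (g \o s), 0 <= C &
    forall z d, 0 <= d -> (forall i, (i < n)%N -> `|e i z| <= d) ->
      (forall j, (j < k)%N -> `|g (s j) z| <= d) ->
      forall i, (i < m)%N -> `|g i z| <= C * d].
Proof.
move=> le lg; elim: m => [|m [n [k [s [C [ind C0 HC]]]]]].
  by exists 0%N, 0%N, id, 0; split=> // p v; exists 0; split=> // i _; apply: scalar_form0.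
have [[p kp]|nk] := pselect (exists p, forall z, (forall i, (i < p)%N -> e i z = 0) ->
    (forall j, (j < k)%N -> g (s j) z = 0) -> g m z = 0).
  pose h i := if (i < p)%N then e i else g (s (i - p)%N).
  have [|z hz|D D0 HD] := @ker_sub_bounded (p + k) h (g m) _ (lg m).
  - by move=> i; rewrite /h; case: ifP.
  - apply: kp => [i ip|j jk].
      by have := hz i; rewrite /h ip; apply; rewrite ltn_addr.
    by have := hz (p + j)%N; rewrite /h ltn_add2l addKn [(p + j < p)%N]ltnNge leq_addr; exact.
  exists (maxn n p), k, s, (C + D); split=> //; first by rewrite addr_ge0.
  move=> z d d0 He Hl i; rewrite ltnS leq_eqVlt mulrDl => /predU1P[->|im].
    rewrite ler_wpDl ?mulr_ge0 //; apply: HD => // j jp; rewrite /h.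
    case: ltnP => [jlp|pj]; first by apply: He; rewrite leq_max jlp orbT.
    by apply: Hl; rewrite ltn_subLR.
  rewrite ler_wpDr ?mulr_ge0 //; apply: HC => // j jn.
  by apply: He; rewrite leq_max jn.
move/forallNP: nk => nk.
exists n, k.+1, (fun j => if j == k then m else s j), (C + 1); split; last 2 first.
- by rewrite addr_ge0.
- move=> z d d0 He Hl i; rewrite ltnS leq_eqVlt mulrDl mul1r => /predU1P[->|im].
    by rewrite ler_wpDl ?mulr_ge0 //; have := Hl k; rewrite eqxx; apply.
  rewrite ler_wpDr //; apply: HC => // j jk.
  by have := Hl j; rewrite ltn_eqF //; apply; rewrite ltnS ltnW.
move=> p v; have [w1 [ew1 lw1]] := ind p v.
have /existsNP[w /not_implyP[ew /not_implyP[lw /eqP gw]]] := nk p.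
(* [w] is killed by the first [p] forms [e i] and by the earlier selected ones, so a multiple of it
   corrects [g m] without disturbing them. *)
exists (w1 + ((v k - g m w1) / g m w) *: w); split=> [i ip|j].
  by rewrite scalar_formD // scalar_formZ // ew1 // ew // mulr0 addr0.
rewrite ltnS leq_eqVlt /= => /predU1P[->|jk].
  by rewrite eqxx scalar_formD // scalar_formZ //; field.
by rewrite ltn_eqF // scalar_formD // scalar_formZ // lw // mulr0 addr0; exact: lw1.
Qed.

End scalar_forms.

(** * Countable closure under choice of witnesses *)

Lemma injective_nat_unbounded (f : nat -> nat) (n : nat) :
  injective f -> exists m, (n <= f m)%N.
Proof.
move=> fI; apply: contrapT => /forallNP Hf.
have fn m : (f m < n)%N by rewrite ltnNge; apply/negP/Hf.
have : injective (fun i : 'I_n.+1 => Ordinal (fn i)).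
  by move=> i j [] /fI ij; apply: val_inj.
by move=> /leq_card; rewrite !card_ord ltnn.
Qed.

(** Entry number [k] of [e] is chosen from the earlier entries: [k] decodes to [(d, n, j, _)] and
    receives the [j]-th term of a witness for [d] and the first [n] entries. The fourth component is
    padding: each task recurs at infinitely many [k], hence at some [k >= n], when those [n] entries
    exist. *)
Lemma skolem_closure (T : Type) (t0 : T) (D : countType)
    (Q : D -> seq T -> (nat -> T) -> Prop) :
  exists e : nat -> T, forall d n l, Q d (mkseq e n) l ->
    exists m : nat -> nat, Q d (mkseq e n) (e \o m).
Proof.
pose ch d s := if pselect (exists l, Q d s l) is left H then sval (cid H)
               else fun=> t0.
pose next (s : seq T) := if (unpickle (size s) : option (D * nat * nat * nat)) is Some (d, n, j, _) then
  ch d (take n s) j else t0.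
have [pad padI] : exists pad : D -> nat -> nat -> nat -> nat, forall d n j m,
    unpickle (pad d n j m) = Some (d, n, j, m) by 
  exists (fun d n j m => pickle (d, n, j, m)) => d n j m; rewrite pickleK.
pose L k := iter k (fun s => rcons s (next s)) [::].
have sL k : size (L k) = k by elim: k => //= k; rewrite size_rcons => ->.
pose e k := next (L k).
have LE k : L k = mkseq e k.
  by elim: k => // k IHk; rewrite mkseqS -IHk.
exists e => d n l Ql.
have H j : exists m, (n <= pad d n j m)%N.
  apply: injective_nat_unbounded => m m' /(congr1 (unpickle : nat -> option (D * nat * nat * nat))).
  by rewrite !padI => -[].
exists (fun j => pad d n j (sval (cid (H j)))).
suff -> : e \o (fun j => pad d n j (sval (cid (H j)))) = ch d (mkseq e n).
  rewrite /ch; case: pselect => [H'|[]]; last by exists l.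
  exact: svalP (cid H').
apply/funext => j /=; case: cid => m /= nm.
rewrite /e /next sL padI; congr (ch d _ j).
by rewrite LE /mkseq -map_take take_iota (minn_idPl nm).
Qed.

(** * Basic weak neighbourhoods and rational approximation *)

Lemma dual_scalar (R : realType) (X : normedModType R) (u : dual X) : scalar u.
Proof. by move=> a y z; rewrite /dual_fun linearP. Qed.

Definition dual0 (R : realType) (X : normedModType R) : dual X :=
  exist (fun f : {linear X -> R^o} => continuous f) \0 (@cst_continuous _ _ 0).

Lemma weak_continuous_nbhs (R : realType) (X : normedModType R)
    (f : weak X -> R) (x : X) (eps : R) : continuous f -> 0 < eps ->
  exists m (g : nat -> dual X) (d : R), 0 < d /\ forall z : X,
    (forall i, (i < m)%N -> `|g i (z - x)| < d) -> `|f z - f x| < eps.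
Proof.
move=> cf eps0.
(* [F] is the filter generated by the basic boxes around [x]. Convergence to [x] in the supremum
   topology is checked one functional at a time. *)
pose F : set_system X := [set A | exists m (g : nat -> dual X) (d : R), 0 < d /\
  forall z, (forall i, (i < m)%N -> `|g i (z - x)| < d) -> A z].
have uB (u : dual X) z : u (z - x) = u z - u x.
  by have := dual_scalar u (-1) x z; rewrite scaleN1r mulN1r !(addrC (- _)).
have FF : Filter F.
  split.
  - by exists 0%N, (fun=> dual0 X), 1.
  - move=> A B [m [g [d [d0 HA]]]] [p [h [c [c0 HB]]]].
    exists (m + p)%N, (fun i => if (i < m)%N then g i else h (i - m)%N), (Num.min d c).
    split=> [|z Hz]; first by rewrite lt_min d0 c0.
    split.
      apply: HA => i im; have := Hz i; rewrite im lt_min ltn_addr // => H.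
      by have /andP[] := H isT.
    apply: HB => i ip; have := Hz (m + i)%N.
    rewrite ltn_add2l [(m + i < m)%N]ltnNge leq_addr addKn lt_min => H.
    by have /andP[] := H ip.
  - by move=> A B AB [m [g [d [d0 HA]]]]; exists m, g, d; split=> // z /HA /AB.
have : F --> (x : weak X).
  apply/cvg_sup => u A; rewrite nbhsE => -[_ [[U oU <-] Uux] sA].
  have /nbhs_ballP[d /= d0 dU] : nbhs (u x) U by apply: open_nbhs_nbhs.
  exists 1%N, (fun=> u), d; split=> // z /(_ 0%N isT) Hz.
  apply: sA; apply: dU; rewrite -ball_normE /=.
  by rewrite distrC -uB.
move=> /(_ (f @^-1` ball (f x) eps)) [].
  by apply: cf; exact: nbhsx_ballx.
move=> m [g [d [d0 H]]]; exists m, g, d; split=> // z /H.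
by rewrite -ball_normE /= distrC.
Qed.

Lemma rat_approx_seq (R : realType) (a : nat -> R) (n : nat) (eps : R) : 0 < eps ->
  exists c : seq rat, forall i, (i < n)%N -> `|a i - ratr c`_i| < eps.
Proof.
move=> eps0.
have /choice[q Hq] i : exists q : rat, `|a i - ratr q| < eps.
  have [|q] := @rat_in_itvoo _ (a i - eps) (a i + eps); first lra.
  by rewrite in_itv /= => /andP[? ?]; exists q; rewrite ltr_norml; lra.
by exists (mkseq q n) => i ni; rewrite nth_mkseq.
Qed.

Lemma finite_pos_min (R : realFieldType) (a : nat -> R) (n : nat) :
  (forall i, (i < n)%N -> 0 < a i) ->
  exists2 d, 0 < d & forall i, (i < n)%N -> d <= a i.
Proof.
elim: n => [|n IHn] a0; first by exists 1.
have [i ni|d d0 Hd] := IHn; first by apply: a0; rewrite ltnW.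
exists (Num.min d (a n)); first by rewrite lt_min d0 a0.
move=> i; rewrite ltnS leq_eqVlt => /predU1P[->|ni]; first by rewrite ge_min lexx orbT.
by rewrite ge_min Hd.
Qed.

(** * Edgar's theorem on the weak Baire sigma-algebra *)

Section edgar.
Context (R : realType) (X : normedModType R).
Implicit Types (u : dual X) (e l : nat -> dual X) (f : weak X -> R).

Definition rat_box (n : nat) (h : nat -> dual X) (c : seq rat) (d : R) : set X :=
  [set z | forall i, (i < n)%N -> `|h i z - ratr c`_i| < d].

Lemma weak_continuous_nbhs_indep f e (x : X) (eps : R) : continuous f -> 0 < eps ->
  exists n k l d, [/\ indep_mod (fun i => e i : X -> R) k (fun j => l j : X -> R), 0 < d &
    forall z : X, (forall i, (i < n)%N -> `|e i z - e i x| <= d) ->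
      (forall j, (j < k)%N -> `|l j z - l j x| <= d) -> `|f z - f x| < eps].
Proof.
move=> cf eps0; have [m [g [d [d0 Hg]]]] := weak_continuous_nbhs x cf eps0.
have [n [k [s [C [ind C0 HC]]]]] := split_forms m
  (fun i => @dual_scalar _ _ (e i)) (fun i => @dual_scalar _ _ (g i)).
(* Dividing by [C + 1] rather than [C] covers [C = 0] and makes the final bound strict. *)
have C1 : 0 < C + 1 by lra.
exists n, k, (g \o s), (d / (C + 1)); split=> //; first exact: divr_gt0.
move=> z Hz Hl; apply: Hg => i im.
have dC : 0 <= d / (C + 1) by rewrite divr_ge0 // ltW.
apply: (@le_lt_trans _ _ (C * (d / (C + 1)))).
  apply: HC im => // [j jn|j jk]; rewrite (scalar_formB (@dual_scalar _ _ _)).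
    exact: Hz.
  exact: Hl.
by rewrite mulrA ltr_pdivrMr // mulrDr mulr1 mulrC ltrDl.
Qed.

(* Loewenheim-Skolem: [e] is closed under choosing witnesses for the rational
   instances of "some box over finitely many [e i] and finitely many further
   functionals lies in [f < r]".  A box [O] around [x] inside [f < r] can thus be
   copied to a box [O''] over the [e i] alone; if [f x' > r] for some [x'] in the
   [e]-part of [O], the extra functionals of a neighbourhood of [x'] are
   independent of the [e i], so that it meets [O'']. *)
Lemma weak_continuous_countable_base f : continuous f ->
  exists e, forall (x : X) (r : rat), f x < ratr r ->
    exists n c (d : rat), rat_box n e c (ratr d) x /\
      rat_box n e c (ratr d) `<=` [set z | f z <= ratr r].
Proof.
move=> cf.
(* Besides the inclusion, [Q] demands that the box be nonempty: its copy over the [e i] must supply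
   the point [z0] used below. *)
pose Q (D : seq rat * rat * nat * seq rat * rat) (s : seq (dual X)) l :=
  let: (c, d, k, c', r) := D in
  let O := rat_box (size s) (nth (dual0 X) s) c (ratr d) `&`
           rat_box k l c' (ratr d) in
  O !=set0 /\ O `<=` [set z | f z < ratr r].
have [e He] := skolem_closure (dual0 X) Q.
exists e => x r fxr.
have [|n [k [l [d0 [ind d00 Hd0]]]]] := @weak_continuous_nbhs_indep f e x (ratr r - f x) cf.
  by rewrite subr_gt0.
have [|d] := @rat_in_itvoo _ 0 (d0 / 2); first by rewrite divr_gt0.
rewrite in_itv /= => /andP[dpos dd0].
have [c Hc] := rat_approx_seq (fun i => e i x) n dpos.
have [c' Hc'] := rat_approx_seq (fun j => l j x) k dpos.
have Osub : rat_box n e c (ratr d) `&` rat_box k l c' (ratr d) `<=`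
    [set z | f z < ratr r].
  move=> z [Oz O'z] /=.
  have : `|f z - f x| < ratr r - f x.
    apply: Hd0 => [i ni|j jk].
      by have := Hc i ni; have := Oz i ni; rewrite ler_norml !ltr_norml; lra.
    by have := Hc' j jk; have := O'z j jk; rewrite ler_norml !ltr_norml; lra.
  by rewrite ltr_norml; lra.
exists n, c, d; split=> // x' Bx' /=; rewrite leNgt; apply/negP => fx'.
have [|n2 [k2 [l2 [d2 [ind2 d20 Hd2]]]]] :=
    @weak_continuous_nbhs_indep f e x' (f x' - ratr r) cf.
  by rewrite subr_gt0.
pose N := maxn n n2.
have [|d3 d30 Hd3] := @finite_pos_min R
    (fun i => ratr d - `|e i x' - ratr c`_i|) n.
  by move=> i ni; rewrite subr_gt0; exact: Bx'.
(* The bound [d] keeps the extra box inside the old one, [d2 / 2] keeps points of the new box within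
   [d2] of [x'] on the [e i], and [d3 / 2] keeps the new box inside the one around [x]. *)
have [|dl] := @rat_in_itvoo _ 0 (Num.min (ratr d) (Num.min (d2 / 2) (d3 / 2))).
  by rewrite !lt_min dpos !divr_gt0.
rewrite in_itv /= !lt_min => /and4P[dl0 dld dld2 dld3].
have [c2 Hc2] := rat_approx_seq (fun i => e i x') N dl0.
have [] := He (c2, dl, k, c', r) N l.
  rewrite /Q size_mkseq; split.
    (* By independence, [x'] can be moved to the centres [c'] of the [l j] while the first [N]
       values [e i x'] stay fixed. *)
    have [w [ew lw]] := ind N (fun j => ratr c'`_j - l j x').
    exists (x' + w); split=> [i iN|j jk].
      rewrite nth_mkseq // (scalar_formD (@dual_scalar _ _ _)) ew // addr0.
      exact: Hc2.
    rewrite (scalar_formD (@dual_scalar _ _ _)) lw // subrKC subrr.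
    by rewrite normr0.
  apply: subset_trans Osub => z [Oz O'z]; split=> [i ni|j jk].
    have iN : (i < N)%N by rewrite leq_max ni.
    have := Oz i iN; rewrite nth_mkseq // => Hz.
    have := Hc2 i iN; have := Hd3 i ni; move: Hz.
    rewrite !ltr_norml lerBrDr -lerBrDl ler_norml; lra.
  exact: lt_trans (O'z j jk) dld.
move=> m; rewrite /Q size_mkseq => -[[z0 [Oz0 O'z0]] sub].
pose M := \max_(j < k) (m j).+1.
(* [z1] has the [e i]-values of [z0] for every index in the copied box, and the [l2 j]-values of
   [x']; this puts [f z1] on both sides of [r]. *)
have [w [ew lw]] := ind2 (maxn N M) (fun j => l2 j x' - l2 j z0).
pose z1 := z0 + w.
have ez1 i : (i < maxn N M)%N -> e i z1 = e i z0.
  by move=> iN; rewrite (scalar_formD (@dual_scalar _ _ _)) ew // addr0.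
have : f z1 < ratr r.
  apply: sub; split=> [i iN|j jk].
    have := Oz0 i iN; rewrite nth_mkseq //= ez1 // leq_max iN //.
  rewrite /= ez1; first exact: O'z0.
  rewrite leq_max; apply/orP; right.
  exact: (leq_bigmax (F := fun j : 'I_k => (m j).+1) (Ordinal jk)).
have : `|f z1 - f x'| < f x' - ratr r.
  apply: Hd2 => [i ni|j jk].
    have iN : (i < N)%N by rewrite leq_max ni orbT.
    rewrite ez1; last by rewrite leq_max iN.
    have := Oz0 i iN; rewrite nth_mkseq // => Hz.
    by have := Hc2 i iN; move: Hz; rewrite ler_norml !ltr_norml; lra.
  rewrite (scalar_formD (@dual_scalar _ _ _)) lw // subrKC subrr normr0.
  exact: ltW.
by rewrite ltr_norml; lra.
Qed.

(** A generating family for the sigma-algebra induced by the dual. *)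
Definition half_spaces : set (set X) :=
  [set A | exists u (t : R), A = [set z | u z < t]].

Lemma measurable_dual u :
  measurable_fun [set: g_sigma_algebraType half_spaces] (u : _ -> R).
Proof.
apply: (measurability _ (RGenInftyO.measurableE R)) => //.
move=> _ [_ [t ->] <-]; apply: sub_sigma_algebra; exists u, t.
by rewrite setTI; apply/seteqP; split=> z /=; rewrite in_itv.
Qed.

Lemma measurable_rat_box n e c (d : R) :
  @measurable _ (g_sigma_algebraType half_spaces) (rat_box n e c d).
Proof.
rewrite (_ : rat_box n e c d =
    \bigcap_(i in `I_n) ([set: X] `&`
      e i @^-1` `]ratr c`_i - d, ratr c`_i + d[)).
  by apply: bigcap_measurableType => i _; exact: measurable_dual.
apply/seteqP; split=> z H i ni.
  by split=> //; rewrite /= in_itv /= -ltr_distl; exact: H.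
by have [_] := H i ni; rewrite /= in_itv /= -ltr_distl.
Qed.

Lemma weak_continuous_measurable f : continuous f ->
  measurable_fun [set: g_sigma_algebraType half_spaces] (f : X -> R).
Proof.
move=> cf; have [e He] := weak_continuous_countable_base cf.
apply: (measurability _ (RGenInftyO.measurableE R)) => //.
move=> _ [_ [t ->] <-].
(* The rational boxes on which [f] stays below some rational [r < t] are countably many and cover
   [[f < t]]. *)
pose B (D : nat * seq rat * rat) := let: (n, c, d) := D in
  if pselect (exists r : rat, ratr r < t /\
    rat_box n e c (ratr d) `<=` [set z | f z <= ratr r])
  then rat_box n e c (ratr d) else set0.
rewrite (_ : _ `&` _ = \bigcup_D B D).
  apply: countable_bigcupT_measurable; first exact: countableP.
  by move=> [[n c] d]; rewrite /B; case: pselect => ?; [exact: measurable_rat_box|exact: measurable0].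
apply/seteqP; split=> [z [_]|z [[[n c] d] _]].
  rewrite /= in_itv /= => fz; have [r] := @rat_in_itvoo _ _ _ fz.
  rewrite in_itv /= => /andP[fr rt]; have [n [c [d [Bz sub]]]] := He z r fr.
  exists (n, c, d) => //; rewrite /B; case: pselect => // -[].
  by exists r.
rewrite /B; case: pselect => // ex /= Bz; split=> //.
have [r [rt sub]] := ex; have fz := sub z Bz.
by rewrite /= in_itv /=; exact: le_lt_trans fz rt.
Qed.

Lemma Ba_sub_half_spaces : <<s @weak_baire R X >> `<=` <<s half_spaces >>.
Proof.
apply: smallest_sub; first exact: smallest_sigma_algebra.
move=> _ [f cf [A mA <-]]; exact: weak_continuous_measurable.
Qed.

End edgar.

(** * The sigma-algebra generated by rectangles *)

Section rectangles.
Context (R : realType) (K : Type).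

Let G := [set A `*` B | A in [set: set K] & B in [set: set K]].

Lemma g_sigma_setU (A B : set (K * K)) :
  <<s G >> A -> <<s G >> B -> <<s G >> (A `|` B).
Proof.
move=> GA GB; rewrite -bigcup2E; apply: sigma_algebra_bigcup => -[|[|i]] //=.
exact: sigma_algebra0.
Qed.

Lemma Kunen_off_diagonal :
  (forall C : set (K * K), (forall a, ~ C (a, a)) -> <<s G >> C) -> Kunen K.
Proof.
move=> HC; rewrite /Kunen -subTset => C _.
have GA : <<s G >> ([set p | ~ C (p.1, p.1)] : set (K * K)).
  apply: sub_sigma_algebra; exists [set a | ~ C (a, a)] => //; exists setT => //.
  by apply/seteqP; split=> -[a b] //= [].
have Goff : <<s G >> [set p : K * K | p.1 <> p.2] by apply: HC => a; apply.
have GCoff : <<s G >> (C `&` [set p | p.1 <> p.2]) by apply: HC => a [_]; apply.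
(* The complement on the right is the diagonal part of [C]: the points with equal coordinates
   outside the rectangle of [GA]. *)
have := g_sigma_setU GCoff (sigma_algebraCD (g_sigma_setU Goff GA)).
congr (<<s _ >> _); apply/seteqP; split=> -[a b] /=.
  by case=> [[]//|[_ /not_orP[/contrapT /= -> /contrapT]]].
move=> Cab; have [ab|ab] := pselect (a = b); last by left.
by right; split=> // -[/(_ ab)|] //; rewrite ab in Cab *.
Qed.

Lemma rectangles_half_plane (u v : K -> R) (t : R) :
  <<s G >> [set p | u p.1 + v p.2 < t].
Proof.
(* [u a + v b < t] means that a rational [q] separates [u a] from [t - v b]. *)
pose S n : set (K * K) := if unpickle n is Some q then
  [set a | u a < ratr (q : rat)] `*` [set b | v b < t - ratr q] else set0.
rewrite (_ : [set p | _] = \bigcup_n S n).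
  apply: sigma_algebra_bigcup => n; rewrite /S.
  case: unpickle => [q|]; last exact: sigma_algebra0.
  apply: sub_sigma_algebra; exists [set a | u a < ratr q] => //.
  by exists [set b | v b < t - ratr q].
apply/seteqP; split=> [[a b] /= uv|[a b] [n _]].
  have [|q] := @rat_in_itvoo _ (u a) (t - v b); first lra.
  rewrite in_itv /= => /andP[uq qv].
  have [n Hn] : exists n, unpickle n = Some q by eexists; exact: pickleK.
  by exists n => //; rewrite /S Hn; split=> /=; lra.
by rewrite /S; case: unpickle => [q [/= ]|//]; lra.
Qed.

(** Sets with a measurable preimage form a sigma-algebra, and on half-spaces a functional splits
    over the sum. *)
Lemma rectangles_preimage_sum (X : normedModType R) (y z : K -> X) (A : set X) :
  <<s @half_spaces R X >> A -> <<s G >> [set p | A (y p.1 + z p.2)].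
Proof.
pose h (p : K * K) := y p.1 + z p.2.
apply: (smallest_sub (C := sigma_algebra setT) (X := [set A | <<s G >> (h @^-1` A)])).
  split=> /= [|B sB|F sF].
  - by rewrite preimage_set0; exact: sigma_algebra0.
  - exact: (sigma_algebraCD sB).
  - by rewrite preimage_bigcup; exact: sigma_algebra_bigcup.
move=> _ [w [t ->]] /=.
have := rectangles_half_plane (fun a => w (y a)) (fun b => w (z b)) t.
congr (<<s _ >> _); apply/seteqP; split=> p /=;
  by rewrite /h (scalar_formD (@dual_scalar _ _ w)).
Qed.

End rectangles.

(** * Equivalent norms from suprema of functionals *)

Lemma dual_bounded (R : realType) (X : normedModType R) (u : dual X) :
  exists2 M, 0 < M & forall z, `|u z| <= M * `|z|.
Proof.
have /continuous_linear_bounded/linear_boundedP := svalP u 0.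
move=> /(filterI (nbhs_pinfty_gt (num_real 0))) /pinfty_ex_gt0[M M0 [_ HM]].
by exists M.
Qed.

Section sup_seminorm.
Context (R : realType) (X : normedModType R) (J : Type).
Variables (B : R) (F : J -> X -> R) (C : set J).
Hypothesis FS : forall c, scalar (F c).
Hypothesis FB : forall c z, `|F c z| <= B * `|z|.
Hypothesis B0 : 0 <= B.

(* The point [0] only matters when [C] is empty. *)
Definition sup_abs (z : X) : R := sup (0 |` [set `|F c z| | c in C]).

Let sup_abs_has_sup z : has_sup (0 |` [set `|F c z| | c in C]).
Proof.
split; first by exists 0; left.
by exists (B * `|z|) => _ [->|[c _ <-]]; [rewrite mulr_ge0|exact: FB].
Qed.

Lemma sup_abs_ge0 z : 0 <= sup_abs z.
Proof. by apply: sup_upper_bound => //; left. Qed.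

Lemma sup_abs_ge z c : C c -> `|F c z| <= sup_abs z.
Proof. by move=> Cc; apply: sup_upper_bound => //; right; exists c. Qed.

Lemma sup_abs_le z b : 0 <= b -> (forall c, C c -> `|F c z| <= b) -> sup_abs z <= b.
Proof.
move=> b0 Hb; apply: ge_sup; first by exists 0; left.
by move=> _ [->|[c Cc <-]] //; exact: Hb.
Qed.

Lemma sup_absZ l z : sup_abs (l *: z) = `|l| * sup_abs z.
Proof.
have leZ k w : sup_abs (k *: w) <= `|k| * sup_abs w.
  apply: sup_abs_le => [|c Cc]; first by rewrite mulr_ge0 // sup_abs_ge0.
  by rewrite scalar_formZ // normrM ler_wpM2l // sup_abs_ge.
apply/eqP; rewrite eq_le leZ /=.
have [->|l0] := eqVneq l 0; first by rewrite normr0 mul0r sup_abs_ge0.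
(* The reverse inequality is [leZ] applied to the inverse scalar. *)
have := leZ l^-1 (l *: z).
by rewrite scalerA mulVf // scale1r normfV ler_pdivlMl // normr_gt0.
Qed.

Lemma equivalent_norm_add_sup_abs : equivalent_norm (fun z : X => `|z| + sup_abs z).
Proof.
split; first split.
- move=> z w; rewrite addrACA lerD ?ler_normD //.
  apply: sup_abs_le => [|c Cc]; first by rewrite addr_ge0 // sup_abs_ge0.
  by rewrite scalar_formD // (le_trans (ler_normD _ _)) // lerD // sup_abs_ge.
- by move=> l z; rewrite normrZ sup_absZ mulrDr.
- move=> z /eqP; rewrite paddr_eq0 ?sup_abs_ge0 // normr_eq0.
  by case/andP => /eqP.
- exists 1, (1 + B); split=> // [|z]; first by rewrite ltr_pwDl.
  rewrite mul1r lerDl sup_abs_ge0 mulrDl mul1r lerD2l.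
  by rewrite sup_abs_le // mulr_ge0.
Qed.

End sup_seminorm.

Lemma equivalent_norm_id (R : realType) (X : normedModType R) :
  equivalent_norm (fun z : X => `|z|).
Proof.
split; first split.
- exact: ler_normD.
- exact: normrZ.
- exact: normr0_eq0.
- by exists 1, 1; split=> // z; rewrite mul1r lexx.
Qed.

Theorem theorem4p4 (R : realType) (X : completeNormedModType R) (I : Type)
    (x : I -> X) (xs : I -> dual X) (hbio : biorthogonal x xs)
    (hI : ~ Kunen I) :
  exists N : X -> R,
    equivalent_norm N /\ ~ measurable_fun [set: Ba X] (N : Ba X -> R).
Proof.
apply: contrapT => /forallNP noN.
have mN N : equivalent_norm N -> measurable_fun [set: Ba X] (N : Ba X -> R).
  by move=> eN; apply: contrapT => nN; exact: (noN N).
apply: hI; apply: Kunen_off_diagonal => C Coff.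
have /choice[M HM] a : exists M : R, 0 < M /\ forall z, `|xs a z| <= M * `|z|.
  by have [M M0 HM] := dual_bounded (xs a); exists M.
have M0 a : 0 < M a by case: (HM a).
pose y a := M a *: x a.
(* The unequal weights 1 and 2 detect order: for [a <> b], the pair [(a, b)] gives 1 + 4 = 5 at
   [y a + 2 *: y b], while [(b, a)] gives only 2 + 2 = 4. *)
pose F (c : I * I) (z : X) := xs c.1 z / M c.1 + 2 * (xs c.2 z / M c.2).
have FS c : scalar (F c).
  by move=> a u v; rewrite /F !(@dual_scalar _ _ _ a); ring.
have FB c z : `|F c z| <= 3 * `|z|.
  have H a : `|xs a z / M a| <= `|z|.
    by rewrite normrM normfV (gtr0_norm (M0 a)) ler_pdivrMr // mulrC; case: (HM a).
  have := H c.1; have := H c.2; rewrite /F !ler_norml; lra.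
pose dl (c a : I) : R := if `[< c = a >] then 1 else 0.
have xsy c a : xs c (y a) / M c = dl c a.
  rewrite (scalar_formZ (@dual_scalar _ _ _)) /dl; case: asboolP => ca.
    by rewrite (hbio c a).1 // ca mulr1 divff // gt_eqF.
  by rewrite (hbio c a).2 // mulr0 mul0r.
(* The formula for [y] is forgotten; only its pairings with the normalized functionals matter from
   here on. *)
move: y xsy => y xsy.
have Fy c a b : F c (y a + 2 *: y b) =
    dl c.1 a + 2 * dl c.1 b + 2 * (dl c.2 a + 2 * dl c.2 b).
  rewrite /F !(scalar_formD (@dual_scalar _ _ _)) !(scalar_formZ (@dual_scalar _ _ _)).
  by rewrite !mulrDl -!mulrA !xsy.
pose p := sup_abs F C.
have mp : measurable_fun [set: Ba X] (p : Ba X -> R).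
  rewrite (_ : p = (fun z => `|z| + p z) \- (fun z => `|z|)); last first.
    by apply/funext => z /=; rewrite addrC addKr.
  apply: measurable_funB; apply: mN; last exact: equivalent_norm_id.
  exact: (equivalent_norm_add_sup_abs C FS FB).
have p5 : <<s @half_spaces R X >> [set z | p z = 5].
  apply: Ba_sub_half_spaces.
  have := mp measurableT _ (measurable_set1 5); rewrite setTI.
  exact.
have := rectangles_preimage_sum y (fun b => 2 *: y b) p5.
congr (<<s _ >> _); apply/seteqP; split=> -[a b] /=.
  move=> pab; apply: contrapT => nCab.
  (* For [a <> b], 4 is the largest value over pairs of distinct indices other than [(a, b)]. *)
  suff : p (y a + 2 *: y b) <= 4 by rewrite pab; lra.
  have [ab|ab] := pselect (a = b).
    subst b.
    apply: sup_abs_le => // -[c d] Ccd.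
    (* On the diagonal the possible values are 0, 3 and 6; since the supremum is 5, the value 6
       cannot occur, and the others are at most 4. *)
    have := sup_abs_ge FB _ (y a + 2 *: y a) Ccd; rewrite -/p pab Fy /= => /(_ (ler0n R 3)).
    have : c <> d by move=> cd; apply: (Coff c); rewrite {2}cd.
    by rewrite /dl; do !case: asboolP => ? //=; rewrite ?ler_norml; (try congruence); lra.
  apply: sup_abs_le => // -[c d] Ccd.
  rewrite Fy /=.
  have : c <> d by move=> cd; apply: (Coff c); rewrite {2}cd.
  rewrite /dl; do !case: asboolP => ? //=; rewrite ?ler_norml; (try congruence); lra.
move=> Cab; apply/eqP; rewrite eq_le; apply/andP; split.
  apply: sup_abs_le => // -[c d] Ccd.
  rewrite Fy /=.
  have : c <> d by move=> cd; apply: (Coff c); rewrite {2}cd.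
  have : a <> b by move=> ab; apply: (Coff a); rewrite {2}ab.
  rewrite /dl; do !case: asboolP => ? //=; rewrite ?ler_norml; (try congruence); lra.
apply: le_trans (sup_abs_ge FB _ (y a + 2 *: y b) Cab) => //.
have : a <> b by move=> ab; apply: (Coff a); rewrite {2}ab.
rewrite Fy /= /dl; do !case: asboolP => ? //=; rewrite ?ler_norml; (try congruence).
by move=> _; apply: le_trans (ler_norm _); lra.
Qed.
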